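(* Let $(X,d)$ be a semimetric space with an upper semicontinuous triangle function $\Phi\colon\mathbb{R}_+^2\to\mathbb{R}_+$ for $d$. Then $(\mathscr{F}(X),D)$ is also a semimetric space and $\Phi$ is also a triangle function for $D$.
   Context: $\mathbb{R}_+=[0,\infty)$. A semimetric space $(X,d)$ is a nonempty set $X$ with a symmetric function $d:X\times X\to\mathbb{R}_+$ (finite-valued) such that $d(x,y)=0$ if and only if $x=y$ (no triangle inequality is assumed). A triangle function for $d$ is a symmetric function $\Phi:\mathbb{R}_+^2\to[0,\infty]$, monotone increasing (in the weak sense) in both arguments, with $\Phi(0,0)=0$ and $d(x,y)\le\Phi(d(x,z),d(z,y))$ for all $x,y,z\in X$; here $\Phi$ is assumed to be finite-valued. For $p\in X$ and $r\in(0,\infty]$, the ball is $\mathscr{B}(p,r)=\{x\in X: d(x,p)<r\}$. A set $A\subseteq X$ is open if for every $p\in A$ there is $r>0$ with $\mathscr{B}(p,r)\subseteq A$; the open sets form a topology on $X$ (balls need not be open), and closed sets are complements of open sets. The diameter of a set is the supremum of the distances of pairs of its points; a set is bounded if its diameter is finite. $\mathscr{F}(X)$ is the family of all nonempty, closed and bounded subsets of $X$. For nonempty $A,B\subseteq X$ the Hausdorff--Pompeiu distance is $$D(A,B)=\inf\Bigl\{\varepsilon\in(0,\infty]\ \Big|\ A\subseteq\bigcup_{b\in B}\mathscr{B}(b,\varepsilon),\ B\subseteq\bigcup_{a\in A}\mathscr{B}(a,\varepsilon)\Bigr\}.$$ *)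

(* Defs.v *)
From HB Require Import structures.
From mathcomp Require Import all_boot all_order all_algebra.
From mathcomp Require Import all_classical all_reals all_analysis.

Set Implicit Arguments.
Unset Strict Implicit.
Unset Printing Implicit Defensive.

Import Order.TTheory GRing.Theory Num.Theory.
Import numFieldNormedType.Exports.

Local Open Scope classical_set_scope.
Local Open Scope ring_scope.

(* No triangle inequality is required. *)
Record semimetric (R : realType) (X : Type) (d : X -> X -> R) : Prop := {
  semimetric_inhabited : inhabited X;
  semimetric_ge0 : forall x y, 0 <= d x y;
  semimetric_sym : forall x y, d x y = d y x;
  semimetric_eq0 : forall x y, d x y = 0 <-> x = y }.

(* A map from R_+^2 to R_+ is encoded as a function R -> R -> R; only its
   values on the closed first quadrant are ever constrained or used. *)
Definition quadrant (R : realType) : set (R * R) :=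
  [set z | 0 <= z.1 /\ 0 <= z.2].

Record triangle_function (R : realType) (X : Type) (d : X -> X -> R)
    (Phi : R -> R -> R) : Prop := {
  triangle_function_ge0 : forall s t, 0 <= s -> 0 <= t -> 0 <= Phi s t;
  triangle_function_sym : forall s t, 0 <= s -> 0 <= t -> Phi s t = Phi t s;
  triangle_function_mono : forall s s' t t',
    0 <= s -> s <= s' -> 0 <= t -> t <= t' -> Phi s t <= Phi s' t';
  triangle_function_00 : Phi 0 0 = 0;
  triangle_function_ineq : forall x y z, d x y <= Phi (d x z) (d z y) }.

(* Upper semicontinuity with respect to the subspace topology of R_+^2. *)
Definition upper_semicontinuous_quadrant (R : realType) (Phi : R -> R -> R) :=
  forall s t c : R, 0 <= s -> 0 <= t -> Phi s t < c ->
    \forall z \near within (@quadrant R) (nbhs (s, t)), Phi z.1 z.2 < c.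

Section SemimetricSets.
Variables (R : realType) (X : Type) (d : X -> X -> R).

Definition smball (p : X) (r : \bar R) : set X :=
  [set x | ((d x p)%:E < r)%E].

Definition smopen (A : set X) : Prop :=
  forall p, A p -> exists2 r : \bar R, (0 < r)%E & smball p r `<=` A.

Definition smclosed (A : set X) : Prop := smopen (~` A).

(* The diameter of the empty set is -oo here. *)
Definition smdiam (A : set X) : \bar R :=
  ereal_sup [set (d x y)%:E | x in A & y in A].

Definition smbounded (A : set X) : Prop := (smdiam A < +oo)%E.

Definition closed_bounded : Type :=
  {A : set X | [/\ A !=set0, smclosed A & smbounded A]}.

(* The value e = +oo is admissible, so the infimum is over a nonempty set. *)
Definition hausdorff_pompeiu (A B : set X) : \bar R :=
  ereal_inf [set e : \bar R | [/\ (0 < e)%E,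
    A `<=` \bigcup_(b in B) smball b e &
    B `<=` \bigcup_(a in A) smball a e]].

End SemimetricSets.

(* Main.v *)
(* Upper semicontinuity of Phi at (s, t) gives some e > 0 with
   Phi (s + e) (t + e) as close to Phi s t as desired.  Hence if C lies within
   s + e of A and within t + e of B, then chaining through C places A within
   Phi (s + e) (t + e) of B, and the triangle inequality for D follows on
   letting e tend to 0.  Definiteness is where closedness enters, and
   finiteness follows from boundedness because Phi is finite-valued. *)
Require Import Defs.
From mathcomp Require Import all_boot all_order all_algebra.
From mathcomp Require Import all_classical all_reals all_analysis.
Import Order.TTheory GRing.Theory Num.Theory.
Import numFieldNormedType.Exports.
Local Open Scope classical_set_scope.
Local Open Scope ring_scope.

Lemma upper_semicontinuous_quadrant_shift (R : realType) (Phi : R -> R -> R)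
    (s t c : R) :
  upper_semicontinuous_quadrant Phi -> 0 <= s -> 0 <= t -> Phi s t < c ->
  exists2 e : R, 0 < e & Phi (s + e) (t + e) < c.
Proof.
move=> usc s0 t0 /(usc _ _ _ s0 t0).
rewrite near_withinE => /nbhs_ballP[e /= e0 He].
(* The ball of radius [e] is open, so a diagonal shift by [e] itself would fall outside it; half of
   it stays inside, and being positive it also stays in the quadrant. *)
have e20 : 0 < e / 2 by rewrite divr_gt0.
have e2e : e / 2 < e by rewrite ltr_pdivrMr// mulr_natr mulr2n ltrDl.
exists (e / 2) => //; apply: (He (s + e / 2, t + e / 2)).
  by split; rewrite /ball/= opprD addrA subrr sub0r normrN gtr0_norm.
by split; rewrite /= addr_ge0// ltW.
Qed.

Section HausdorffPompeiu.
Context {R : realType} {X : Type} {d : X -> X -> R}.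
Implicit Types (A B C : set X).

(** One of the two inclusions in [hausdorff_pompeiu], at a real radius. Keeping the directions apart
    lets each be chained and bounded on its own. *)
Let within_dist (e : R) A B := forall a, A a -> exists2 b, B b & d a b < e.

Lemma hausdorff_pompeiu_sym A B :
  hausdorff_pompeiu d A B = hausdorff_pompeiu d B A.
Proof.
by congr ereal_inf; apply/seteqP; split => e [e0 AB BA]; split.
Qed.

Lemma hausdorff_pompeiu_ge0 A B : (0 <= hausdorff_pompeiu d A B)%E.
Proof. by apply: le_ereal_inf_tmp => e [/ltW]. Qed.

Lemma hausdorff_pompeiu_le (e : R) A B :
  0 < e -> within_dist e A B -> within_dist e B A ->
  (hausdorff_pompeiu d A B <= e%:E)%E.
Proof.
move=> e0 AB BA; apply: ereal_inf_lbound; split; first by rewrite lte_fin.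
- by move=> a /AB[b Bb dab]; exists b => //; rewrite /smball/= lte_fin.
- by move=> b /BA[a Aa dba]; exists a => //; rewrite /smball/= lte_fin.
Qed.

Lemma hausdorff_pompeiu_lt (e : R) A B :
  (hausdorff_pompeiu d A B < e%:E)%E -> within_dist e A B.
Proof.
move=> /ereal_inf_lt[r [_ AB _] re] a /AB[b Bb dab].
by exists b => //; rewrite -lte_fin (lt_trans dab).
Qed.

Lemma within_dist_trans (Phi : R -> R -> R) (s t c : R) A B C :
  semimetric d -> triangle_function d Phi -> Phi s t < c ->
  within_dist s A C -> within_dist t C B -> within_dist c A B.
Proof.
move=> sd tPhi Phic AC CB a /AC[z /CB[b Bb dzb] daz]; exists b => //.
apply: (le_lt_trans (triangle_function_ineq tPhi a b z)).
apply: le_lt_trans Phic.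
by apply: (triangle_function_mono tPhi) => //;
  rewrite ?(semimetric_ge0 sd)// ltW.
Qed.

Lemma smbounded_dist A :
  smbounded d A -> A !=set0 -> exists M, forall x y, A x -> A y -> d x y <= M.
Proof.
move=> bA [a Aa].
have dA x y : A x -> A y -> ((d x y)%:E <= smdiam d A)%E.
  by move=> Ax Ay; apply: ereal_sup_ubound; exists x => //; exists y.
exists (fine (smdiam d A)) => x y Ax Ay.
(* The point [a] keeps the supremum away from [-oo], so [fine] returns the true diameter. *)
have finA : smdiam d A \is a fin_num.
  by rewrite fin_numElt bA andbT (lt_le_trans _ (dA _ _ Aa Aa))// ltNyr.
by rewrite -lee_fin fineK// dA.
Qed.

(** A single [b] serves every [x] in [A]: going through a fixed [a] in [A], the distance from [x] to
    [b] is at most [Phi M (d a b)], where [M] bounds the distances within [A]. *)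
Lemma smbounded_within_dist (Phi : R -> R -> R) A B :
  semimetric d -> triangle_function d Phi -> smbounded d A -> A !=set0 ->
  B !=set0 -> exists e, forall r, e < r -> within_dist r A B.
Proof.
move=> sd tPhi bA A0 [b Bb]; have [M dM] := smbounded_dist _ bA A0.
have [a Aa] := A0.
exists (Phi M (d a b)) => r Mr x Ax; exists b => //; apply: le_lt_trans Mr.
apply: (le_trans (triangle_function_ineq tPhi x b a)).
by apply: (triangle_function_mono tPhi) => //;
  rewrite ?(semimetric_ge0 sd)// dM.
Qed.

Lemma hausdorff_pompeiu_fin_num (Phi : R -> R -> R) A B :
  semimetric d -> triangle_function d Phi ->
  A !=set0 -> smbounded d A -> B !=set0 -> smbounded d B ->
  hausdorff_pompeiu d A B \is a fin_num.
Proof.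
move=> sd tPhi A0 bA B0 bB.
have [e AB] := smbounded_within_dist _ _ _ sd tPhi bA A0 B0.
have [f BA] := smbounded_within_dist _ _ _ sd tPhi bB B0 A0.
(* The 0 makes the radius positive and the added 1 makes it strictly larger than both [e] and
   [f]. *)
pose r := Num.max 0 (Num.max e f) + 1.
have lt_r x : x <= Num.max 0 (Num.max e f) -> x < r.
  by move=> xr; rewrite (le_lt_trans xr)// ltrDl.
rewrite ge0_fin_numE ?hausdorff_pompeiu_ge0//.
apply: (@le_lt_trans _ _ r%:E); last exact: ltry.
apply: hausdorff_pompeiu_le; [apply: lt_r|apply/AB/lt_r|apply/BA/lt_r];
  by rewrite !le_max lexx ?orbT.
Qed.

Lemma hausdorff_pompeiu_id A : semimetric d -> hausdorff_pompeiu d A A = 0%E.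
Proof.
move=> sd; apply/le_anti; rewrite hausdorff_pompeiu_ge0 andbT.
apply/lee_addgt0Pr => e e0; rewrite add0e.
have AA : within_dist e A A.
  by move=> a Aa; exists a => //; rewrite (semimetric_eq0 sd _ _).2.
exact: hausdorff_pompeiu_le.
Qed.

(** A point outside the closed set [B] has a ball that misses [B], while distance zero puts a point
    of [B] in every ball around each point of [A]. *)
Lemma hausdorff_pompeiu0_sub A B : semimetric d -> smclosed d B ->
  hausdorff_pompeiu d A B = 0%E -> A `<=` B.
Proof.
move=> sd cB AB0 a Aa; apply: contrapT => /cB[r r0 rB].
(* The radius [r] may be [+oo]; a smaller real radius is used instead. *)
have [e e0 er] : exists2 e : R, 0 < e & (e%:E <= r)%E.
  case: r r0 {rB} => [r|_|//]; last by exists 1 => //; rewrite leey.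
  by rewrite lte_fin => r0; exists r.
have /hausdorff_pompeiu_lt/(_ a Aa)[b Bb dab] :
  (hausdorff_pompeiu d A B < e%:E)%E by rewrite AB0 lte_fin.
apply: (rB b) => //; rewrite /smball/= (semimetric_sym sd).
by apply: lt_le_trans er; rewrite lte_fin.
Qed.

Lemma hausdorff_pompeiu_triangle (Phi : R -> R -> R) (s t : R) A B C :
  semimetric d -> triangle_function d Phi -> upper_semicontinuous_quadrant Phi ->
  hausdorff_pompeiu d A C = s%:E -> hausdorff_pompeiu d C B = t%:E ->
  (hausdorff_pompeiu d A B <= (Phi s t)%:E)%E.
Proof.
move=> sd tPhi usc ACs CBt.
have s0 : 0 <= s by rewrite -lee_fin -ACs hausdorff_pompeiu_ge0.
have t0 : 0 <= t by rewrite -lee_fin -CBt hausdorff_pompeiu_ge0.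
apply/lee_addgt0Pr => c c0.
have [e e0 Phie] : exists2 e, 0 < e & Phi (s + e) (t + e) < Phi s t + c.
  by apply: upper_semicontinuous_quadrant_shift => //; rewrite ltrDl.
have se0 : 0 <= s + e by rewrite addr_ge0// ltW.
have te0 : 0 <= t + e by rewrite addr_ge0// ltW.
rewrite -EFinD; apply: hausdorff_pompeiu_le.
- by rewrite ltr_wpDl// (triangle_function_ge0 tPhi).
- apply: (within_dist_trans _ _ _ _ _ _ C sd tPhi Phie);
    by apply: hausdorff_pompeiu_lt; rewrite ?ACs ?CBt lte_fin ltrDl.
(* The way back runs from [B] through [C] to [A], so the radii [t + e] and [s + e] come in the
   opposite order. *)
- rewrite (triangle_function_sym tPhi)// in Phie.
  apply: (within_dist_trans _ _ _ _ _ _ C sd tPhi Phie);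
    by apply: hausdorff_pompeiu_lt;
    rewrite hausdorff_pompeiu_sym ?ACs ?CBt lte_fin ltrDl.
Qed.

(** Singletons show that the space of closed bounded sets is inhabited. *)
Lemma closed_bounded_set1 (x : X) : semimetric d ->
  [/\ [set x] !=set0, smclosed d [set x] & smbounded d [set x]].
Proof.
move=> sd; split; first by exists x.
(* Balls are strict, so the one around [p] of radius [d x p] just misses [x]. *)
- move=> p px; exists (d x p)%:E.
    rewrite lte_fin lt0r (semimetric_ge0 sd) andbT.
    by apply/eqP => /(semimetric_eq0 sd) xp; apply: px.
  by move=> q /=; rewrite /smball/= lte_fin => + qx; rewrite qx ltxx.
- apply: (@le_lt_trans _ _ (d x x)%:E); last exact: ltry.
  by apply: ge_ereal_sup => _ [y -> [z -> <-]].
Qed.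

End HausdorffPompeiu.

Theorem theorem7 (R : realType) (X : Type) (d : X -> X -> R)
    (Phi : R -> R -> R) :
  semimetric d ->
  triangle_function d Phi ->
  upper_semicontinuous_quadrant Phi ->
  let D := fun A B : closed_bounded d =>
    hausdorff_pompeiu d (proj1_sig A) (proj1_sig B) in
  [/\ forall A B, D A B \is a fin_num,
      semimetric (fun A B => fine (D A B)) &
      triangle_function (fun A B => fine (D A B)) Phi].
Proof.
move=> sd tPhi usc D.
have finD A B : D A B \is a fin_num.
  have [A0 _ bA] := proj2_sig A; have [B0 _ bB] := proj2_sig B.
  exact: (hausdorff_pompeiu_fin_num Phi).
split=> //; split.
- have [x] := semimetric_inhabited sd.
  by constructor; exists [set x]; apply: closed_bounded_set1.
- by move=> A B; rewrite fine_ge0// hausdorff_pompeiu_ge0.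
- by move=> A B; rewrite /D hausdorff_pompeiu_sym.
- move=> A B; split=> [DAB0|->]; last by rewrite /D hausdorff_pompeiu_id.
  have AB0 : D A B = 0%E by rewrite -(fineK (finD A B)) DAB0.
  (* By proof irrelevance, elements of [closed_bounded] are equal once their underlying sets are. *)
  apply: eq_sig_hprop => [?|]; first exact: Prop_irrelevance.
  have [_ cA _] := proj2_sig A; have [_ cB _] := proj2_sig B.
  apply/seteqP; split; apply: (hausdorff_pompeiu0_sub _ _ sd) => //.
  by rewrite hausdorff_pompeiu_sym.
- exact: triangle_function_ge0 tPhi.
- exact: triangle_function_sym tPhi.
- exact: triangle_function_mono tPhi.
- exact: triangle_function_00 tPhi.
- move=> A B C; rewrite -lee_fin fineK//.
  by apply: (hausdorff_pompeiu_triangle _ _ _ _ _ (proj1_sig C));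
    rewrite ?fineK//; apply: finD.
Qed.
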